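(* Let $p$ be a prime and let $A,B\subseteq\mathbb{Z}/p\mathbb{Z}$ with $|A|\ge 5$, $|B|\ge 2$, $p\ge |A|+|B|$, and $|A\widehat{+}B|=|A|+|B|-3$. If there exist $\tau,d\in\mathbb{Z}/p\mathbb{Z}$ with $d\neq 0$ such that $A=\{\tau+id: i=0,1,\dots,|A|-1\}$, then $A=B$ (so $(A,B)$ is a standard pair: $A=B$ is such an arithmetic progression).
   Context: For $A,B\subseteq\mathbb{Z}/p\mathbb{Z}$, the restricted sumset is $A\widehat{+}B=\{a+b \bmod p: a\in A,\ b\in B,\ a\neq b\}$. A set of the form $\{\tau+id: i=0,\dots,|A|-1\}$ with $d\neq0$ is a standard set; $(A,B)$ is a standard pair if $A=B$ and both are standard sets. *)

(* Defs.v *)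
From mathcomp Require Import all_boot all_algebra.

Set Implicit Arguments.
Unset Strict Implicit.
Unset Printing Implicit Defensive.

Import GRing.Theory.
Local Open Scope ring_scope.

(* For prime p, 'F_p is the ring Z/pZ; every use below assumes p prime. *)
Definition restricted_sumset (p : nat) (A B : {set 'F_p}) : {set 'F_p} :=
  [set a + b | a in A, b in B & a != b].

Definition standard_set (p : nat) (A : {set 'F_p}) : Prop :=
  exists tau d : 'F_p,
    d != 0 /\ A = [set tau + d *+ i | i : 'I_#|A|].

Definition standard_pair (p : nat) (A B : {set 'F_p}) : Prop :=
  [/\ A = B, standard_set A & standard_set B].

(* Main.v *)
(* Let k = #|A|, let A + B be the full sumset, and call b in A :&: B special if
   b + b lies outside the restricted sumset; then #|A + B| <= k + #|B| - 3 + s,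
   where s is the number of special elements. If b = tau + i d is special, then
   none of b + d, ..., b + i d and b - d, ..., b - (k - 1 - i) d is in B, since
   b + b = (b - j d) + (b + j d). Filling these gaps from the right and from the
   left bounds #|A + B| below twice; adding the two bounds gives
   2 #|A + B| >= 2 #|B| + s (k - 1), whence s <= 2 because k > 3. By
   Cauchy-Davenport s = 2 and #|A + B| = k + #|B| - 1, which forces B to be a
   progression of difference d, and its ends can only be those of A. *)

Require Import Defs.
From mathcomp Require Import all_boot all_algebra.
From mathcomp Require Import zify.

Set Implicit Arguments.
Unset Strict Implicit.
Unset Printing Implicit Defensive.

Import GRing.Theory.
Local Open Scope ring_scope.

(** The sumset of [B] with 0, [d], ..., (k - 1) [d]. It is the full sumset A + B translated by -
    tau, so the start of A drops out of all counting. *)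
Definition progression_sum (V : finZmodType) (B : {set V}) (d : V) (k : nat) :
  {set V} := [set b + d *+ i | b : V in B, i : 'I_k].

Lemma mem_progression_sum (V : finZmodType) (B : {set V}) (d b : V) (k i : nat) :
  b \in B -> (i < k)%N -> b + d *+ i \in progression_sum B d k.
Proof. by move=> bB ik; apply/imset2P; exists b (Ordinal ik). Qed.

(* The points b + d *+ j with 0 <= j <= f b are pairwise distinct: each
   determines b as the last element of B at or before it along d. *)
Lemma leq_gaps_progression_sum (V : finZmodType) (B : {set V}) (d : V) (k : nat)
    (f : V -> nat) :
  {in B, forall b, (f b < k)%N} ->
  {in B, forall b j, (0 < j <= f b)%N -> b + d *+ j \notin B} ->
  (\sum_(b in B) (f b).+1 <= #|progression_sum B d k|)%N.
Proof.
move=> fk gap.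
pose X := [set x : V * 'I_k | (x.1 \in B) && (x.2 <= f x.1)%N].
pose g (x : V * 'I_k) := x.1 + d *+ x.2.
have collide (b b' : V) (j j' : nat) : b \in B -> b' \in B -> (j' <= f b')%N ->
    b + d *+ j = b' + d *+ j' -> (j' <= j)%N.
  move=> bB b'B j'f e; rewrite leqNgt; apply/negP => jj'.
  have /negP[] := gap b' b'B (j' - j)%N ltac:(lia).
  by rewrite mulrnBr ?(ltnW jj') // addrA -e addrK.
have injg : {in X &, injective g}.
  move=> [b j] [b' j']; rewrite !inE /g /= => /andP[bB jf] /andP[b'B j'f] e.
  have ejj' : j = j'.
    by apply/val_inj/anti_leq; rewrite (collide _ _ _ _ _ _ _ (esym e)) ?(collide _ _ _ _ _ _ _ e).
  by move: e; rewrite ejj' => /addIr ->.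
have -> : (\sum_(b in B) (f b).+1 = #|X|)%N.
  rewrite -sum1_card (eq_bigl (fun x : V * 'I_k =>
    (x.1 \in B) && (x.2 <= f x.1)%N)); last by move=> x; rewrite inE.
  rewrite -(pair_big_dep (mem B) (fun b (j : 'I_k) => (j <= f b)%N) (fun _ _ => 1%N)) /=.
  apply: eq_bigr => b bB.
  by rewrite (big_ord_narrow (fk b bB)) sum1_card card_ord.
rewrite -(card_in_imset injg); apply/subset_leq_card/subsetP => _ /imsetP[x xX ->].
by move: xX; rewrite inE => /andP[xB _]; apply: mem_progression_sum.
Qed.

Lemma sub_progression_sum (V : finZmodType) (B : {set V}) (d : V) (k : nat) :
  B \subset progression_sum B d k.+1.
Proof.
by apply/subsetP=> b bB; rewrite -[b]addr0 -(mulr0n d) mem_progression_sum.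
Qed.

Lemma progression_sumS (V : finZmodType) (B : {set V}) (d : V) (k : nat) :
  progression_sum B d k.+2 = progression_sum (progression_sum B d k.+1) d 2.
Proof.
apply/setP=> x; apply/imset2P/imset2P.
  move=> [b [[|i] /= ik] bB _ ->].
    exists b ord0 => //; exact: (subsetP (sub_progression_sum B d k)).
  exists (b + d *+ i) (lift ord0 ord0); rewrite ?mem_progression_sum //=.
  by rewrite mulrSr addrA.
move=> [_ [i i2] /imset2P[b j bB _ ->] _ ->] /=.
have lt : (j + i < k.+2)%N by have := ltn_ord j; lia.
by exists b (Ordinal lt); rewrite //= mulrnDr addrA.
Qed.

Lemma card_progression_sumN (V : finZmodType) (B : {set V}) (d : V) (k : nat) :
  #|progression_sum B (- d) k| = #|progression_sum B d k|.
Proof.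
wlog suff le : d / (#|progression_sum B (- d) k| <= #|progression_sum B d k|)%N.
  by apply/anti_leq; rewrite le -{1}(opprK d) le.
(* Translation by (k - 1) d carries b - i d to b + (k - 1 - i) d. *)
rewrite -(card_imset _ (addIr (d *+ k.-1))).
apply/subset_leq_card/subsetP => _ /imsetP[_ /imset2P[b i bB _ ->] ->].
rewrite mulNrn -addrA [- _ + _]addrC -mulrnBr; last by have := ltn_ord i; lia.
by apply: mem_progression_sum => //; have := ltn_ord i; lia.
Qed.

(** Every x in [B] with x + d outside [B] contributes the new point x + d, and there is room for
    only one. *)
Lemma progression_sum2_unique_end (V : finZmodType) (B : {set V}) (d : V) :
  (#|progression_sum B d 2| <= #|B|.+1)%N ->
  {in B &, forall x y, x + d \notin B -> y + d \notin B -> x = y}.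
Proof.
move=> le x y xB yB xd yd; apply: (addIr d); apply/eqP; apply: contraT => ne.
have : (#|B :|: [set (x + d)%R; (y + d)%R]| <= #|B|.+1)%N.
  apply: leq_trans le; apply/subset_leq_card.
  rewrite subUset sub_progression_sum subUset !sub1set -[d]mulr1n.
  by rewrite !mem_progression_sum.
rewrite cardsU cards2 ne disjoint_setI0 ?cards0; first lia.
by rewrite disjoint_sym disjoints_subset subUset !sub1set !inE xd yd.
Qed.

Section PrimeField.
Variables (p : nat) (p_prime : prime p).
Implicit Types (B C : {set 'F_p}) (d : 'F_p).

Lemma mulrn_Fp_eq0 d n : d != 0 -> (n < p)%N -> (d *+ n == 0) = (n == 0)%N.
Proof.
move=> d0 np; rewrite -mulr_natr mulf_eq0 (negPf d0) /=.
rewrite -(dvdn_pcharf (pchar_Fp p_prime)).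
by apply/idP/eqP => [|-> //]; case: n np => // n np /dvdn_leq; lia.
Qed.

Lemma subr_mulrn_neq_addr (b d : 'F_p) j : d != 0 -> (2 < p)%N ->
  (0 < j < p)%N -> b - d *+ j != b + d *+ j.
Proof.
move=> d0 p2 /andP[j0 jp]; rewrite (inj_eq (addrI b)) eq_sym -addr_eq0.
by rewrite -mulr2n !mulrn_Fp_eq0 // -lt0n.
Qed.

(** A nonzero [d] generates Z/pZ additively, so from any c in [C] the shifts reach [x0], after (x0 -
    c) / d steps. *)
Lemma shift_stable_Fp d C x0 : d != 0 ->
  {in C, forall x, x + d \in C} -> x0 \notin C -> C = set0.
Proof.
move=> d0 st x0C; apply/setP=> c; rewrite inE; apply/negP => cC.
have cn n : c + d *+ n \in C.
  by elim: n => [|n IH]; rewrite ?addr0 // mulrSr addrA st.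
move/negP: x0C; apply; have := cn (val ((x0 - c) / d)).
by rewrite -mulr_natr natr_Zp mulrC divfK // addrC subrK.
Qed.

Lemma card_progression_sum2 B d : d != 0 -> B != set0 -> B != setT ->
  (#|B| < #|progression_sum B d 2|)%N.
Proof.
move=> d0 Bn0 BnT; apply: proper_card; rewrite properE sub_progression_sum /=.
apply: contra Bn0 => /subsetP sub.
have [x0 x0B] : exists x0, x0 \notin B.
  apply/existsP; rewrite -negb_forall; apply: contra BnT => /forallP h.
  by apply/eqP/setP => x; rewrite h inE.
apply/eqP/(shift_stable_Fp d0 _ x0B) => x xB.
by apply: sub; rewrite -[d]mulr1n mem_progression_sum.
Qed.

(** Cauchy-Davenport for a progression: each further term adds a point until the group is full. The
    first step is kept apart so that an upper bound on the whole sum can be turned into one on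
    [progression_sum B d 2]. *)
Lemma card_progression_sum B d k : d != 0 -> B != set0 ->
  (#|progression_sum B d k.+2| < p)%N ->
  (#|progression_sum B d 2| + k <= #|progression_sum B d k.+2|)%N.
Proof.
move=> d0 Bn0; elim: k => [|k IH]; first by rewrite addn0.
rewrite progression_sumS; set C := progression_sum B d k.+2 in IH * => lt_p.
have leC := subset_leq_card (sub_progression_sum C d 1).
have ltC : (#|C| < p)%N by lia.
have CnT : C != setT.
  by apply: contraTneq ltC => ->; rewrite cardsT card_Fp // ltnn.
have Cn0 : C != set0.
  case/set0Pn: Bn0 => b bB; apply/set0Pn; exists b.
  exact: (subsetP (sub_progression_sum B d _)).
by rewrite addnS; apply: leq_ltn_trans (IH ltC) (card_progression_sum2 d0 Cn0 CnT).
Qed.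

End PrimeField.

Theorem theorem7 (p : nat) (p_prime : prime p) (A B : {set 'F_p})
    (hA : (5 <= #|A|)%N) (hB : (2 <= #|B|)%N)
    (hp : (#|A| + #|B| <= p)%N)
    (hAB : #|restricted_sumset A B| = (#|A| + #|B| - 3)%N)
    (stdA : exists tau d : 'F_p,
        d != 0 /\ A = [set tau + d *+ i | i : 'I_#|A|]) :
  A = B /\ standard_pair A B.
Proof.
suff eAB : A = B by split=> //; split=> //; rewrite -eAB.
case: stdA => tau [d [d0 eA]].
move: hA hp hAB eA; set k := #|A| => hA hp hAB eA.
set S := restricted_sumset A B in hAB *.
have memA i : (i < k)%N -> tau + d *+ i \in A.
  by move=> ik; rewrite eA; apply/imsetP; exists (Ordinal ik).
(* The implication makes the index total: outside [A] it is arbitrary, but still below [k]. *)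
have idxP b : exists i, (i < k)%N && ((b \in A) ==> (b == tau + d *+ i)).
  have [|_] := boolP (b \in A); last by exists 0%N; lia.
  by rewrite {1}eA => /imsetP[i _ ->]; exists i; rewrite ltn_ord eqxx.
pose idx b : nat := xchoose (idxP b).
have idx_lt b : (idx b < k)%N by have /andP[] := xchooseP (idxP b).
have idxE b : b \in A -> b = tau + d *+ idx b.
  by move=> bA; have /andP[_ /implyP/(_ bA)/eqP] := xchooseP (idxP b).
have idx_le b : (idx b <= k.-1)%N by have := idx_lt b; lia.
pose omega := tau + d *+ k.-1.
have ne_to : tau != omega.
  by rewrite /omega -subr_eq0 opprD addrA subrr add0r oppr_eq0 mulrn_Fp_eq0 //; lia.
have omega_topA : omega + d \notin A.
  apply/negP => /idxE e; move: e (idx_lt (omega + d)).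
  move: (idx (omega + d)) => i /eqP e ik; move: e.
  rewrite /omega -addrA -mulrSr prednK; last lia.
  rewrite (inj_eq (addrI tau)) -subr_eq0 -mulrnBr ?(ltnW ik) //.
  by rewrite mulrn_Fp_eq0 //; lia.
have stepA x : x \in A -> x != omega -> x + d \in A.
  move=> /idxE -> ne; rewrite -addrA -mulrSr; apply: memA.
  have := idx_lt x; rewrite leq_eqVlt => /predU1P[ik|//].
  by case/eqP: ne; rewrite /omega -ik.
have backA x : x \in A -> x != tau -> x - d \in A.
  move=> /idxE ->; have := idx_lt x; case: (idx x) => [|i] ik ne.
    by rewrite addr0 eqxx in ne.
  by rewrite mulrSr addrA addrK memA // ltnW.
pose T := [set b in A :&: B | b + b \notin S].
have neq_opp b j : (0 < j < k)%N -> b - d *+ j != b + d *+ j.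
  by move=> jk; apply: subr_mulrn_neq_addr => //; lia.
have symm b j : b \in T -> (0 < j < k)%N -> b - d *+ j \in A -> b + d *+ j \notin B.
  rewrite !inE => /andP[_ bS] jk bjA; apply: contra bS => bjB.
  have -> : b + b = (b - d *+ j) + (b + d *+ j) by rewrite addrACA addNr addr0.
  by apply: imset2_f; rewrite // inE bjB neq_opp.
have symm' b j : b \in T -> (0 < j < k)%N -> b + d *+ j \in A -> b - d *+ j \notin B.
  rewrite !inE => /andP[_ bS] jk bjA; apply: contra bS => bjB.
  have -> : b + b = (b + d *+ j) + (b - d *+ j) by rewrite addrACA subrr addr0.
  by apply: imset2_f; rewrite // inE bjB eq_sym neq_opp.
have gapR b j : b \in T -> (0 < j <= idx b)%N -> b + d *+ j \notin B.
  move=> bT jb; have lt := idx_lt b; apply: symm => //; first lia.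
  have bA : b \in A by move: bT; rewrite !inE => /andP[/andP[]].
  rewrite {1}(idxE _ bA) -addrA -mulrnBr; last lia.
  by apply: memA; lia.
have gapL b j : b \in T -> (0 < j <= k.-1 - idx b)%N -> b - d *+ j \notin B.
  move=> bT jb; have lt := idx_lt b; apply: symm' => //; first lia.
  have bA : b \in A by move: bT; rewrite !inE => /andP[/andP[]].
  by rewrite {1}(idxE _ bA) -addrA -mulrnDr; apply: memA; lia.
have TB : T \subset B by apply/subsetP => b; rewrite !inE => /andP[/andP[]].
pose N := #|progression_sum B d k|.
(* After translation by [tau], a sum a + b lies in [S] if a and b differ; otherwise it is b + b,
   which is in [S] unless b is in [T]. *)
have N_le : (N <= #|S| + #|T|)%N.
  rewrite /N -(card_imset _ (addIr tau)).
  have : [set x + tau | x in progression_sum B d k] \subset S :|: [set b + b | b in T].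
    apply/subsetP=> _ /imsetP[_ /imset2P[b i bB _ ->] ->]; rewrite inE.
    have -> : b + d *+ i + tau = (tau + d *+ i) + b
      by rewrite addrC [b + _]addrC addrA.
    have aA : tau + d *+ i \in A by apply: memA.
    have [e|ne] := eqVneq (tau + d *+ i) b.
      rewrite e in aA *; have [//|bS /=] := boolP (b + b \in S).
      by apply: (imset_f (fun b => b + b)); rewrite !inE aA bB.
    by apply/orP; left; apply: imset2_f; rewrite // inE bB.
  move/subset_leq_card/leq_trans; apply; apply: leq_trans (leq_card_setU _ _) _.
  by rewrite leq_add2l leq_imset_card.
have sumT (g : 'F_p -> nat) :
    (\sum_(b in B) (if b \in T then g b else 0).+1 = #|B| + \sum_(b in T) g b)%N.
  rewrite (eq_bigr (fun b => 1 + if b \in T then g b else 0)%N) // big_split /= sum1_card.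
  congr addn; rewrite -big_mkcondr /=; apply: eq_bigl => b.
  by apply: andb_idl; apply: (subsetP TB).
have right_count : (#|B| + \sum_(b in T) idx b <= N)%N.
  rewrite -sumT; apply: leq_gaps_progression_sum => b bB; first by have := idx_lt b; case: ifP; lia.
  by move=> j; case: ifP => [bT|]; [exact: gapR | lia].
have left_count : (#|B| + \sum_(b in T) (k.-1 - idx b) <= N)%N.
  rewrite -sumT /N -card_progression_sumN; apply: leq_gaps_progression_sum => b bB.
    by have := idx_lt b; case: ifP; lia.
  by move=> j; rewrite mulNrn; case: ifP => [bT|]; [exact: gapL | lia].
have both : (\sum_(b in T) idx b + \sum_(b in T) (k.-1 - idx b) = #|T| * k.-1)%N.
  rewrite -big_split -sum_nat_const; apply: eq_bigr => b _ /=.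
  by have := idx_lt b; lia.
(* With t = |T|, 2 |B| + t (k - 1) <= 2 N <= 2 (k + |B| - 3 + t), so t (k - 3) <= 2 (k - 3). *)
have T_le2 : (#|T| <= 2)%N by nia.
have Bn0 : B != set0 by rewrite -card_gt0; lia.
have BnT : B != setT by apply: contraTneq hp => ->; rewrite cardsT card_Fp //; lia.
(* Here N <= k + |B| - 1 < p, by [T_le2] and [hp]. *)
have small : (#|progression_sum B d 2| + (k - 2) <= N)%N.
  have ek : k = (k - 2).+2 by lia.
  rewrite /N {2}ek; apply: card_progression_sum => //; rewrite -ek -/N; lia.
have grow := card_progression_sum2 d0 Bn0 BnT.
(* |B| + 1 + (k - 2) <= N <= k + |B| - 3 + |T| forces |T| >= 2; [small] then leaves B + {0, d} at
   most one point more than [B]. *)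
have /eqP/cards2P[u [v [neuv eT]]] : #|T| = 2%N by lia.
have le1 : (#|progression_sum B d 2| <= #|B|.+1)%N by lia.
have top := progression_sum2_unique_end le1.
have bot : {in B &, forall x y, x - d \notin B -> y - d \notin B -> x = y}.
  by apply: progression_sum2_unique_end; rewrite card_progression_sumN.
have [uT vT] : u \in T /\ v \in T by rewrite eT !inE !eqxx orbT.
have [uB vB] := (subsetP TB _ uT, subsetP TB _ vT).
have TA b : b \in T -> b \in A by rewrite !inE => /andP[/andP[]].
have topT b : b \in T -> b != tau -> b + d \notin B.
  move=> bT ne; apply: (gapR b 1%N) => //; rewrite /= lt0n.
  by apply: contraNneq ne => i0; rewrite (idxE _ (TA _ bT)) i0 addr0.
have botT b : b \in T -> b != omega -> b - d \notin B.
  move=> bT ne; apply: (gapL b 1%N) => //.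
  rewrite /= subn_gt0 ltn_neqAle idx_le andbT.
  by apply: contraNneq ne => i0; rewrite (idxE _ (TA _ bT)) i0.
(* If neither [u] nor [v] were [tau], both would be right ends of [B], hence equal by [top]. The
   case of [omega] is the mirror image, with left ends. *)
have tauT : tau \in T.
  apply: contraT => tauT; case/eqP: neuv; apply: top => //; apply: topT => //;
  by apply: contraNneq tauT => <-.
have omegaT : omega \in T.
  apply: contraT => omegaT; case/eqP: neuv; apply: bot => //; apply: botT => //;
  by apply: contraNneq omegaT => <-.
have tau_bot := botT _ tauT ne_to.
have omega_top : omega + d \notin B by apply: topT => //; rewrite eq_sym.
have [tauB omegaB] := (subsetP TB _ tauT, subsetP TB _ omegaT).
have Nd0 : - d != 0 by rewrite oppr_eq0.
(* Both differences A \ B and B \ A are stable under the shift by - d and miss [tau], hence are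
   empty. *)
apply/eqP; rewrite eqEsubset -!setD_eq0; apply/andP; split; apply/eqP.
  apply: (shift_stable_Fp Nd0 (x0 := tau)); last by rewrite inE tauB.
  move=> x; rewrite !inE => /andP[xB xA].
  have xt : x != tau by apply: contraNneq xB => ->.
  rewrite backA // andbT; apply: contra xB => xdB.
  apply: contraT => xB; have e : x - d = omega by apply: top; rewrite ?subrK.
  by rewrite -(subrK d x) e (negPf omega_topA) in xA.
apply: (shift_stable_Fp Nd0 (x0 := tau)); last by rewrite inE TA.
move=> x; rewrite !inE => /andP[xA xB].
have xt : x != tau by apply: contraNneq xA => ->; apply: TA.
apply/andP; split.
  apply: contra xA => xdA; rewrite -(subrK d x); apply: stepA => //.
  by apply: contraNneq omega_top => <-; rewrite subrK.
by apply: contraNT xt => xdB; apply/eqP/bot.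
Qed.
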